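(* There exists a numerical constant $c>0$ such that the following holds. Let $(E,\|\cdot\|)$ be a real normed vector space with norm degree $\eta_{\|\cdot\|}=\eta(E,\|\cdot\|)$, let $Z\in E$ be a random vector, $\tilde Z\in E$ a deterministic vector, $C\ge e$, $q>0$ and $\sigma>0$. Then $$Z\in\tilde Z\pm Ce^{-(\cdot/\sigma)^q}\ \Longrightarrow\ \|Z-\tilde Z\|\in0\pm Ce^{-\frac{(\cdot/2\sigma)^q}{2c\,\eta_{\|\cdot\|}}}.$$ Reciprocally, $$\|Z-\tilde Z\|\in0\pm Ce^{-(\cdot/\sigma)^q}\ \Longrightarrow\ Z\in\tilde Z\pm Ce^{-(\cdot/\sigma)^q}.$$
   Context: For a non-increasing $\alpha:\mathbb R_+\to\mathbb R_+$ (values above $1$ read as $1$) and a real random variable $W$, $W\in a\pm\alpha$ means $\mathbb P(|W-a|\ge t)\le\alpha(t)$ for all $t>0$; the dot in $\alpha$ stands for $t$. For a random vector $Z$ of $(E,\|\cdot\|)$ and deterministic $\tilde Z\in E$, $Z\in\tilde Z\pm\alpha$ (linear concentration) means $u(Z)\in u(\tilde Z)\pm\alpha$ for every linear form $u:E\to\mathbb R$ with $|u(z)|\le\|z\|$ for all $z\in E$. Norm degree: for a subset $H\subset E^*$ (dual space, dual norm $\|\cdot\|_*$), let $\mathcal B_H=\{f\in H:\|f\|_*\le1\}$, and $\eta_H=\log(\#H)$ if $H$ is finite, $\eta_H=\dim(\operatorname{Vect}H)$ (dimension of the linear span) if $H$ is infinite. Then $$\eta_{\|\cdot\|}=\eta(E,\|\cdot\|)=\inf\left\{\eta_H:\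 H\subset E^*,\ \forall x\in E,\ \|x\|=\sup_{f\in\mathcal B_H}f(x)\right\}.$$ *)

(* Defs.v *)
From HB Require Import structures.
From mathcomp Require Import all_boot all_order all_algebra finmap.
From mathcomp Require Import all_classical all_reals all_analysis.

Set Implicit Arguments.
Unset Strict Implicit.
Unset Printing Implicit Defensive.

Import Order.TTheory GRing.Theory Num.Theory.
Import numFieldNormedType.Exports.

Local Open Scope classical_set_scope.
Local Open Scope ring_scope.

(* Linear span and (Hamel) dimension of arbitrary subsets of a left module that
   need not be finite-dimensional; the vspaces of MathComp only cover finite
   dimension. *)

Definition lin_indep (R : pzRingType) (V : lmodType R) (n : nat)
    (v : 'I_n -> V) : Prop :=
  forall a : 'I_n -> R, \sum_(i < n) a i *: v i = 0 -> forall i, a i = 0.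

Definition lin_span (R : pzRingType) (V : lmodType R) (A : set V) : set V :=
  [set x | exists (n : nat) (a : 'I_n -> R) (v : 'I_n -> V),
    (forall i, A (v i)) /\ x = \sum_(i < n) a i *: v i].

(* The largest number of linearly independent elements of the subspace S,
   +oo when there is no largest one. *)
Definition lin_dim (R : realType) (V : lmodType R) (S : set V) : \bar R :=
  ereal_sup [set (n%:R)%:E | n in
    [set n : nat | exists v : 'I_n -> V, (forall i, S (v i)) /\ lin_indep v]].

Definition dual (R : realType) (E : normedModType R) : set (E -> R^o) :=
  [set f : E -> R^o | linear f /\ continuous f].
Arguments dual {R} E _.

Definition dual_norm (R : realType) (E : normedModType R) (f : E -> R^o) :
    \bar R :=
  ereal_sup [set `|f x|%:E | x in [set x : E | `|x| <= 1]].

Definition dual_ball (R : realType) (E : normedModType R) (H : set (E -> R^o)) :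
    set (E -> R^o) :=
  H `&` [set f | (dual_norm f <= 1)%E].

Definition eta_set (R : realType) (E : normedModType R) (H : set (E -> R^o)) :
    \bar R :=
  if `[< finite_set H >] then (ln (#|` fset_set H|%fset%:R : R))%:E
  else lin_dim (lin_span H).

(* The supremum is taken in \bar R, where sup set0 = -oo: thus the empty H
   never satisfies the constraint, and the value ln 0 = 0 of the library is
   never used. *)
Definition norming (R : realType) (E : normedModType R) (H : set (E -> R^o)) :
    Prop :=
  forall x : E, `|x|%:E = ereal_sup [set (f x : R)%:E | f in dual_ball H].

Definition norm_degree (R : realType) (E : normedModType R) : \bar R :=
  ereal_inf [set eta_set H | H in
    [set H : set (E -> R^o) | H `<=` dual E /\ norming H]].

(* Tail functions take values in \bar R because their exponents are divided by
   the norm degree, which may be +oo (x / +oo = 0) or, when E is trivial, 0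
   (x / 0 = +oo for x > 0). *)
Definition concentrated (R : realType) (d : measure_display)
    (T : measurableType d) (P : probability T R) (W : T -> R) (a : R)
    (alpha : R -> \bar R) : Prop :=
  forall t : R, 0 < t ->
    (P [set w | t <= `|W w - a|]%R <= mine (alpha t) 1)%E.

Definition lin_concentrated (R : realType) (d : measure_display)
    (T : measurableType d) (P : probability T R) (E : normedModType R)
    (Z : T -> E) (z0 : E) (alpha : R -> \bar R) : Prop :=
  forall u : {linear E -> R^o}, (forall z : E, `|u z| <= `|z|) ->
    concentrated P (u \o Z) (u z0) alpha.

(* Measurability with respect to the Borel sigma-algebra of the norm topology. *)
Definition random_vector (R : realType) (d : measure_display)
    (T : measurableType d) (E : normedModType R) (Z : T -> E) : Prop :=
  measurable_fun setT (Z : T -> g_sigma_algebraType (@open E)).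

(* Main.v *)
Require Import Defs.
From HB Require Import structures.
From mathcomp Require Import all_boot all_order all_algebra finmap.
From mathcomp Require Import all_classical all_reals all_analysis.
From mathcomp Require Import lra zify.

Set Implicit Arguments.
Unset Strict Implicit.
Unset Printing Implicit Defensive.

Import Order.TTheory GRing.Theory Num.Theory.
Import numFieldNormedType.Exports.

Local Open Scope classical_set_scope.
Local Open Scope ring_scope.

(* If finitely many functionals g_1, ..., g_M of dual norm at most 1 satisfy
   |x| <= 2 max_i g_i x, a union bound gives a tail M C exp(- (t / 2 sigma)^q)
   for |Z - z0|; capping probabilities at 1 turns this into
   C exp(- (t / 2 sigma)^q / (2 c eta)) as soon as ln M <= 6 eta and M >= 2
   (M = 1 forces E to be trivial). A finite norming set H provides such a
   family with ln M <= eta_H. If H is infinite with a span of dimension n, take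
   a net with at most 8 ^ n points in the unit ball of the span, so that
   ln M <= 3 eta_H. Choosing eta_H < 2 eta costs another factor 2 and avoids
   showing that the infimum defining eta is attained. *)

(** * Nets in the unit ball of a norm on row vectors *)

(** Greedy choice: an element joins [W] only when far from all those already kept; otherwise one of
    these covers it. *)
Lemma maximal_separated_subseq (T : eqType) (close : rel T) (s : seq T) :
  reflexive close -> symmetric close ->
  exists W : seq T, [/\ uniq W, {subset W <= s},
    {in W &, forall x y, close x y -> x = y} &
    {in s, forall x, exists2 w, w \in W & close x w}].
Proof.
move=> cxx csym; elim: s => [|x s [W [uW Ws Wsep scov]]]; first by exists [::].
have [/hasP[w wW xw]|/hasPn far] := boolP (has (close x) W).
  exists W; split => // [y /Ws ys|y].
    by rewrite inE ys orbT.
  by rewrite inE => /predU1P[->|/scov//]; exists w.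
exists (x :: W); split => //=.
- by rewrite uW andbT; apply/negP => /far; rewrite cxx.
- by move=> y; rewrite !inE => /predU1P[->|/Ws ->]; rewrite ?eqxx ?orbT.
- move=> y z; rewrite !inE => /predU1P[->|yW] /predU1P[->|zW] //.
  + by move=> xz; have := far _ zW; rewrite xz.
  + by rewrite csym => xy; have := far _ yW; rewrite xy.
  + exact: Wsep.
- move=> y; rewrite inE => /predU1P[->|/scov[w wW yw]].
    by exists x => //; rewrite inE eqxx.
  by exists w => //; rewrite inE wW orbT.
Qed.

Section NormRow.
Variables (R : realType) (n : nat) (p : 'rV[R]_n -> R).
Hypothesis pD : forall a b, p (a + b) <= p a + p b.
Hypothesis pZ : forall k a, p (k *: a) = `|k| * p a.
Hypothesis p0 : forall a, p a = 0 -> a = 0.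

Let pN a : p (- a) = p a.
Proof. by rewrite -scaleN1r pZ normrN1 mul1r. Qed.

Let pz : p 0 = 0.
Proof. by rewrite -(scale0r 0) pZ normr0 mul0r. Qed.

Let p_ge0 a : 0 <= p a.
Proof. by have := pD a (- a); rewrite subrr pz pN; lra. Qed.

Let pB a b : p (a - b) = p (b - a).
Proof. by rewrite -pN opprB. Qed.

(** A Lipschitz constant of [p] for the sup norm. *)
Let basis_sum := \sum_(i < n) p (delta_mx 0 i).

Let basis_sum_ge0 : 0 <= basis_sum.
Proof. by apply: sumr_ge0. Qed.

Let p_le_sup (a : 'rV[R]_n) (M : R) :
  (forall i, `|a 0 i| <= M) -> p a <= M * basis_sum.
Proof.
move=> aM; rewrite [a]row_sum_delta.
have -> : M * basis_sum = \sum_(i < n) M * p (delta_mx 0 i).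
  by rewrite mulr_sumr.
elim/big_ind2 : _ => [|x1 x2 y1 y2 h1 h2|i _]; first by rewrite pz.
  exact: le_trans (pD _ _) (lerD h1 h2).
by rewrite pZ ler_wpM2r.
Qed.

(** [p] is continuous, so it attains a minimum on the compact unit sphere of the sup norm. The
    minimum is positive by definiteness, and [L] is its inverse. *)
Lemma coord_le_norm : exists2 L : R, 0 < L &
  forall (a : 'rV[R]_n) i, `|a 0 i| <= L * p a.
Proof.
pose A := [set a : 'rV[R]_n | `|a| = 1].
have coord_norm (a : 'rV[R]_n) i : `|a 0 i| <= `|a|.
  rewrite [leRHS]/Num.norm /= mx_normrE; apply/bigmax_geP.
  by right => /=; exists (0, i).
(* For [n = 0] the sphere is empty, and zero is the only vector. *)
have [A0|/nonemptyPn A0] := pselect (A !=set0); last first.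
  exists 1 => // a i; have [->|a0] := eqVneq a 0.
    by rewrite mxE normr0 mul1r.
  have : A (`|a|^-1 *: a).
    by rewrite /A /= normrZ normfV normr_id mulVf ?normr_eq0.
  by rewrite A0.
have cA : compact A.
  apply: bounded_closed_compact.
    by exists 1; split => // M M1 a /= ->; exact: ltW.
  apply: (@closed_comp _ _ (fun a : 'rV[R]_n => `|a|) [set 1]).
    by move=> a _; exact: norm_continuous.
  exact: closed_eq.
have cp : continuous p.
  move=> a; apply/(@cvgrPdist_le _ _ _ _ (nbhs_filter a)) => e e0.
  have d0 : 0 < e / (1 + basis_sum) by rewrite divr_gt0// ltr_pwDl.
  apply: (@filterS _ _ (nbhs_filter a) _ _ _ (nbhsx_ballx a _ d0)) => b.
  rewrite -ball_normE /= ltr_pdivlMr ?ltr_pwDl// => /ltW abe.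
  apply: (@le_trans _ _ (p (a - b))).
    rewrite ler_norml; have := pD (a - b) b; have := pD (b - a) a.
    by rewrite !subrK (pB b a); lra.
  apply: le_trans (p_le_sup (fun i => coord_norm _ i)) _.
  by apply: le_trans abe; rewrite ler_wpM2l// lerDr.
have [c Ac cmin] := EVT_min_rV A0 cA (continuous_subspaceT cp).
have pc0 : 0 < p c.
  rewrite lt_neqAle p_ge0 andbT eq_sym; apply/eqP => /p0 c0.
  by move: Ac; rewrite inE /A /= c0 normr0 => /eqP; rewrite eq_sym oner_eq0.
exists (p c)^-1; first by rewrite invr_gt0.
move=> a i; rewrite mulrC ler_pdivlMr//; apply: le_trans (_ : `|a| * p c <= _).
  by rewrite ler_wpM2r// ltW.
have [->|a0] := eqVneq a 0; first by rewrite normr0 mul0r.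
have : p c <= p (`|a|^-1 *: a).
  by apply: cmin; rewrite inE /A /= normrZ normfV normr_id mulVf ?normr_eq0.
by rewrite pZ normfV normr_id mulrC ler_pdivlMr ?normr_gt0// mulrC.
Qed.

Let lattice_point (eps : R) (k : 'rV[int]_n) : 'rV[R]_n := eps *: map_mx intr k.

Let lattice_pointD eps k l :
  lattice_point eps (k + l) = lattice_point eps k + lattice_point eps l.
Proof. by rewrite /lattice_point map_mxD scalerDr. Qed.

Let lattice_pointB eps k l :
  lattice_point eps (k - l) = lattice_point eps k - lattice_point eps l.
Proof. by rewrite /lattice_point map_mxB scalerBr. Qed.

Let finite_lattice_ball (eps r : R) : 0 < eps ->
  exists2 s : seq 'rV[int]_n, uniq s &
    forall k, (k \in s) = (p (lattice_point eps k) <= r).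
Proof.
move=> eps0; have [L L0 Lp] := coord_le_norm.
pose N := `|Num.ceil (L * r / eps)|%N.
(* Values in [0..2N] shifted down by [N] enumerate all integer rows with coordinates in
   [[-N, N]]. *)
pose box := [seq (\row_i ((f i : nat)%:Z - N%:Z) : 'rV[int]_n) |
              f : {ffun 'I_n -> 'I_(N + N).+1}].
exists [seq k <- undup box | p (lattice_point eps k) <= r].
  by rewrite filter_uniq// undup_uniq.
move=> k; rewrite mem_filter mem_undup andb_idr// => pk.
have kN i : `|k 0 i| <= N%:Z.
  have : `|(k 0 i)%:~R| <= L * r / eps :> R.
    rewrite ler_pdivlMr//.
    have := Lp (lattice_point eps k) i; rewrite !mxE normrM gtr0_norm// => h.
    by rewrite mulrC; apply: le_trans h _; rewrite ler_wpM2l// ltW.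
  move=> h; have : (`|k 0 i|%:~R : R) <= (Num.ceil (L * r / eps))%:~R.
    by rewrite intr_norm; apply: le_trans h _; exact: ceil_ge.
  rewrite ler_int => h'; apply: le_trans h' _.
  by rewrite /N abszE ler_norm.
apply/mapP; exists [ffun i => inord (absz (k 0 i + N%:Z))].
  by rewrite mem_enum.
apply/rowP => i; rewrite !mxE ffunE inordK; have := kN i; lia.
Qed.

(* A maximal separated subset W of the points of a fine lattice lying in the
   unit ball is a net. If S r denotes the lattice points in the ball of radius
   r, then W + S (1/6) is a direct sum inside S (7/6), and dividing coordinates
   by 8 with remainder shows #S (7/6) <= 8 ^ n * #S (1/6): this replaces the
   usual comparison of volumes. *)
Lemma net_unit_ball : exists W : seq 'rV[R]_n,
  [/\ (size W <= 8 ^ n)%N, {in W, forall w, p w <= 1} &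
      forall a, p a <= 1 -> exists2 w, w \in W & p (a - w) <= 2 / 5].
Proof.
(* The mesh is chosen so that rounding to the lattice costs at most 1/50 in [p]. *)
have [eps eps0 epsb] : exists2 eps, 0 < eps & eps * basis_sum <= 1 / 50.
  have b0 : 0 < 1 + basis_sum by rewrite ltr_pwDl.
  exists (50 * (1 + basis_sum))^-1; first by rewrite invr_gt0 mulr_gt0.
  rewrite invfM -mulrA [_^-1 * basis_sum]mulrC.
  have : basis_sum / (1 + basis_sum) <= 1 by rewrite ler_pdivrMr// mul1r lerDr.
  by lra.
pose emb := lattice_point eps.
have [S1 uS1 S1E] := finite_lattice_ball 1 eps0.
(* The radius 1/6 below is half of the separation 1/3, and 7/6 = 1 + 1/6. *)
have [Sbig uSbig SbigE] := finite_lattice_ball (7 / 6) eps0.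
have [Ssmall uSsmall SsmallE] := finite_lattice_ball (1 / 6) eps0.
pose close k l := p (emb (k - l)) <= 1 / 3.
have closexx : reflexive close.
  by move=> k; rewrite /close /emb /lattice_point subrr map_mx0 scaler0 pz; lra.
have closeC : symmetric close.
  by move=> k l; rewrite /close /emb !lattice_pointB pB.
have [W [uW WS1 Wsep Wcov]] := maximal_separated_subseq S1 closexx closeC.
have sizeW1 : (size W * size Ssmall <= size Sbig)%N.
  rewrite -(size_allpairs (fun w v => w + v)); apply: uniq_leq_size.
    apply: allpairs_uniq => // -[w v] [w' v'] /=.
    move=> /allpairsP[[w1 v1] [w1W v1S [ew ev]]].
    move=> /allpairsP[[w2 v2] [w2W v2S [ew' ev']]].
    move: w1W v1S w2W v2S; rewrite /= -{}ew -{}ev -{}ew' -{}ev'.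
    move=> wW vS w'W v'S wv.
    (* Two ways of writing a sum give [w - w' = v' - v], of norm at most 1/6 + 1/6; so [w] and [w']
       are close, hence equal. *)
    have ww' : w - w' = v' - v.
      rewrite -(addrK v w) wv [w' + v']addrC -!addrA; congr (_ + _).
      by rewrite addrC subrK.
    have ww : w = w'.
      apply: Wsep => //; rewrite /close ww' /emb lattice_pointB.
      move: vS v'S; rewrite !SsmallE => vS v'S.
      by apply: le_trans (pD _ _) _; rewrite pN; lra.
    by move: wv; rewrite ww => /addrI ->.
  move=> _ /allpairsP[[w v] /= [/WS1 wS vS ->]].
  move: wS vS; rewrite S1E SbigE SsmallE lattice_pointD => wS vS.
  by apply: le_trans (pD _ _) _; lra.
have sizeW2 : (size Sbig <= size Ssmall * 8 ^ n)%N.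
  pose f (k : 'rV[int]_n) (e : {ffun 'I_n -> 'I_8}) :=
    8%:Z *: k + \row_i (e i : nat)%:Z.
  pose fs := [seq f k e | k <- Ssmall, e <- enum {: {ffun 'I_n -> 'I_8}}].
  have <- : size fs = (size Ssmall * 8 ^ n)%N.
    by rewrite size_allpairs -cardE card_ffun !card_ord.
  suff sub (k : 'rV[int]_n) : k \in Sbig -> k \in fs by exact: uniq_leq_size.
  rewrite SbigE => pk.
  pose k' : 'rV[int]_n := \row_i divz (k 0 i) 8.
  pose e := [ffun i => inord (absz (modz (k 0 i) 8)) : 'I_8].
  have kE : k = f k' e.
    by apply/rowP => i; rewrite !mxE ffunE inordK; lia.
  apply/allpairsP; exists (k', e); split; rewrite /= ?mem_enum//.
  have embk' : 8 *: emb k' = emb k - emb (\row_i (e i : nat)%:Z).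
    rewrite /emb -lattice_pointB {1}kE /f addrK /lattice_point map_mxZ.
    by rewrite !scalerA mulrC.
  have pe : p (emb (\row_i (e i : nat)%:Z)) <= 7 / 50.
    apply: (@le_trans _ _ (eps * 7 * basis_sum)); last by lra.
    apply: p_le_sup => i; rewrite !mxE normrM gtr0_norm//.
    rewrite (ler_wpM2l (ltW eps0))//.
    by rewrite -pmulrn normr_nat ler_nat -ltnS.
  (* (7/6 + 7/50) / 8 is below 1/6, so the quotient [k'] falls in [Ssmall]. *)
  have := pD (emb k) (- emb (\row_i (e i : nat)%:Z)).
  rewrite SsmallE -embk' pZ pN ger0_norm// -/emb.
  by move: pk; rewrite -/emb; lra.
have Ssmall_gt0 : (0 < size Ssmall)%N.
  case: Ssmall SsmallE {sizeW1 sizeW2 uSsmall} => // /(_ 0).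
  by rewrite /lattice_point map_mx0 scaler0 pz in_nil divr_ge0.
exists (map emb W); split.
- rewrite size_map -(leq_pmul2r Ssmall_gt0) [leqRHS]mulnC.
  exact: leq_trans sizeW1 sizeW2.
- by move=> _ /mapP[w /WS1 wS ->]; rewrite -S1E.
- move=> a a1.
  (* Shrinking by 49/50 keeps the rounded point in the unit ball. The total error is 1/50 + 1/50 +
     1/3, below 2/5. *)
  pose b := (49 / 50) *: a.
  pose k : 'rV[int]_n := \row_i Num.floor (b 0 i / eps).
  have pbk : p (b - emb k) <= 1 / 50.
    apply: le_trans epsb; apply: p_le_sup => i.
    have -> : (b - emb k) 0 i =
        eps * (b 0 i / eps - (Num.floor (b 0 i / eps))%:~R).
      by rewrite mulrBr [eps * (_ / _)]mulrC divfK ?gt_eqF// !mxE.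
    rewrite normrM gtr0_norm// (ler_piMr (ltW eps0))//.
    have := floor_itv (b 0 i / eps).
    by rewrite intrD mulr1z ler_norml => /andP[? ?]; apply/andP; split; lra.
  have pb : p b <= 49 / 50 by rewrite pZ ger0_norm; lra.
  have kS : k \in S1.
    rewrite S1E; have := pD b (emb k - b); rewrite addrC subrK pB.
    by rewrite -/(emb k); lra.
  have [w wW kw] := Wcov _ kS.
  exists (emb w); first exact: map_f.
  have pab : p (a - b) <= 1 / 50.
    have -> : a - b = (1 / 50) *: a.
      by rewrite -{1}(scale1r a) -scalerBl; congr (_ *: _); lra.
    by rewrite pZ ger0_norm; lra.
  have -> : a - emb w = (a - b) + ((b - emb k) + emb (k - w)).
    by rewrite /emb lattice_pointB !addrA !subrK.
  have := pD (a - b) ((b - emb k) + emb (k - w)).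
  have := pD (b - emb k) (emb (k - w)).
  by move: kw; rewrite /close; lra.
Qed.

End NormRow.

(** * From norming sets to finite families of functionals *)

Lemma linear_family (R : realType) (E : normedModType R) (M : nat)
    (f : 'I_M -> E -> R^o) : (forall i, linear (f i)) ->
  exists g : 'I_M -> {linear E -> R^o}, forall i, g i = f i :> (E -> R^o).
Proof.
move=> lf.
have lin (h : E -> R^o) : linear h ->
    exists g : {linear E -> R^o}, g = h :> (E -> R^o).
  move=> lh; pose lhM := GRing.isLinear.Build _ _ _ _ h lh.
  by exists (HB.pack_for {linear E -> R^o} h lhM).
by have [g gf] := choice (fun i => lin _ (lf i)); exists g.
Qed.

Lemma dual_ball_le (R : realType) (E : normedModType R) (H : set (E -> R^o))
    (f : E -> R^o) : H `<=` dual E -> dual_ball H f ->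
  linear f /\ forall x, `|f x| <= `|x|.
Proof.
move=> HE [/HE[lf _] /= f1]; split => // x.
have fZ k y : f (k *: y) = k * f y.
  have f0 : f 0 = 0.
    by have := lf 1 0 0; rewrite scaler0 addr0 scale1r => /eqP;
      rewrite -subr_eq subrr => /eqP.
  by have := lf k y 0; rewrite addr0 f0 addr0.
have [->|x0] := eqVneq x 0.
  by rewrite -(scale0r 0) fZ mul0r !normr0.
have : (`|f (`|x|^-1 *: x)|%:E <= 1)%E.
  apply: le_trans f1; apply: ereal_sup_ubound; exists (`|x|^-1 *: x) => //=.
  by rewrite normrZ normfV normr_id mulVf ?normr_eq0.
rewrite fZ normrM normfV normr_id lee_fin mulrC ler_pdivrMr ?normr_gt0//.
by rewrite mul1r.
Qed.

(** The supremum may not be attained, hence a factor below 1. With the net error 2/5 it leaves 9/10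
    - 2/5 = 1/2. *)
Lemma norming_witness (R : realType) (E : normedModType R)
    (H : set (E -> R^o)) (x : E) : H `<=` dual E -> norming H ->
  exists2 f, dual_ball H f & 9 / 10 * `|x| <= f x.
Proof.
move=> HE nH; have [->|x0] := eqVneq x 0.
  (* At 0 the strict inequality used below fails; a member exists because the supremum of the empty
     set is [-oo]. *)
  have [[f Hf]|/nonemptyPn H0] := pselect (dual_ball H !=set0).
    exists f => //; have [_ /(_ 0)] := dual_ball_le HE Hf.
    by rewrite normr0 mulr0 normr_le0 => /eqP ->.
  by have := nH 0; rewrite H0 image_set0 ereal_sup0.
have : ((9 / 10 * `|x|)%:E < `|x|%:E)%E.
  by rewrite lte_fin; have : 0 < `|x|; [rewrite normr_gt0|lra].
rewrite [X in (_ < X)%E]nH => /ereal_sup_gt[_ [f Hf <-]].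
by rewrite lte_fin => /ltW; exists f.
Qed.

(** A largest independent family in [A] spans [A]. Drawing it from [A] and not from its span keeps,
    when [A] is a dual ball, the norms of its members at most 1. *)
Lemma lin_indep_maximal (R : realType) (V : lmodType R) (A : set V) :
  (lin_dim (lin_span A) < +oo)%E ->
  exists (m : nat) (v : 'I_m -> V), [/\ forall i, A (v i), lin_indep v,
    (m%:R%:E <= lin_dim (lin_span A))%E &
    forall x, A x -> exists a : 'rV[R]_m, x = \sum_i a 0 i *: v i].
Proof.
pose Q m := `[< exists v : 'I_m -> V, (forall i, A (v i)) /\ lin_indep v >].
have Qdim m : Q m -> (m%:R%:E <= lin_dim (lin_span A))%E.
  move=> /asboolP[v [Av iv]]; apply: ereal_sup_ubound; exists m => //.
  exists v; split => // i; exists 1%N, (fun=> 1), (fun=> v i).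
  by rewrite big_ord1 scale1r.
have Q0 : Q 0%N.
  by apply/asboolP; exists (fun=> 0); split => [[]|a _ []].
move: Qdim (Qdim _ Q0); case: (lin_dim _) => // r Qdim r0 _.
have Qle m : Q m -> (m <= Num.truncn r)%N.
  by move=> /Qdim; rewrite lee_fin truncn_ge_nat.
have [m Qm mmax] := ex_maxnP (ex_intro _ 0%N Q0) Qle.
have /asboolP[v [Av iv]] := Qm.
exists m, v; split => //; first exact: Qdim.
(* By maximality, adding [x] breaks independence. The coefficient of [x] in the resulting relation
   is nonzero because [v] is independent, so the relation can be solved for [x]. *)
move=> x Ax; pose v' (i : 'I_m.+1) := oapp v x (unlift ord0 i).
have : ~ lin_indep v'.
  move=> iv'; suff /mmax : Q m.+1 by rewrite ltnn.
  apply/asboolP; exists v'; split => // i.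
  by rewrite /v'; case: (unliftP ord0 i) => [j|] _ /=.
move=> /existsNP[a /not_implyP[]]; rewrite big_ord_recl /v' unlift_none /=.
under eq_bigr do rewrite liftK /=.
move=> av a0; have a00 : a ord0 != 0.
  apply: contra_notN a0 => /eqP a0; move: av.
  rewrite a0 scale0r add0r => /iv aj i.
  by case: (unliftP ord0 i) => [j ->|->].
exists (\row_i (- (a ord0)^-1 * a (lift ord0 i))).
under eq_bigr do rewrite mxE -scalerA.
rewrite -scaler_sumr; move: av => /eqP; rewrite addrC addr_eq0 => /eqP ->.
by rewrite scalerN scaleNr opprK scalerA mulVf// scale1r.
Qed.

(** [p a] is the dual norm of [phi a] as a real number: finite since each [v i] is bounded by the
    norm, definite by independence. It lets the net be built on coefficient rows. *)
Lemma linear_combination_sup_norm (R : realType) (E : normedModType R) (m : nat)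
    (v : 'I_m -> E -> R^o) (phi := fun a : 'rV[R]_m => \sum_i a 0 i *: v i) :
  (forall i, linear (v i)) -> (forall i x, `|v i x| <= `|x|) -> lin_indep v ->
  exists p : 'rV[R]_m -> R, [/\ forall a b, p (a + b) <= p a + p b,
    forall k a, p (k *: a) = `|k| * p a, forall a, p a = 0 -> a = 0,
    forall a x, `|phi a x| <= p a * `|x| &
    forall a c, (forall x, `|phi a x| <= c * `|x|) -> 0 <= c -> p a <= c].
Proof.
move=> lv v1 iv.
have phiE a x : phi a x = \sum_i a 0 i * v i x by rewrite /phi fct_sumE.
have vZ i k x : v i (k *: x) = k * v i x.
  have [g gv] := linear_family lv.
  by rewrite -gv linearZ.
have phiZ a k x : phi a (k *: x) = k * phi a x.
  by rewrite !phiE mulr_sumr; apply: eq_bigr => i _; rewrite vZ mulrCA.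
have phiDl a b x : phi (a + b) x = phi a x + phi b x.
  by rewrite !phiE -big_split; apply: eq_bigr => i _; rewrite mxE mulrDl.
have phiZl k a x : phi (k *: a) x = k * phi a x.
  by rewrite !phiE mulr_sumr; apply: eq_bigr => i _; rewrite mxE mulrA.
pose S a := [set `|phi a x| | x in [set x : E | `|x| <= 1]].
have S0 a : S a !=set0 by exists `|phi a 0|, 0; rewrite //= normr0.
have Sub a : has_ubound (S a).
  exists (\sum_i `|a 0 i|) => _ [x /= x1 <-]; rewrite phiE.
  apply: le_trans (ler_norm_sum _ _ _) _; apply: ler_sum => i _.
  by rewrite normrM ler_piMr// (le_trans (v1 _ _)).
pose p a := sup (S a).
have p_ge a x : `|phi a x| <= p a * `|x|.
  have [->|x0] := eqVneq x 0.
    by rewrite -(scale0r 0) phiZ mul0r normrZ !normr0 mul0r mulr0.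
  rewrite -ler_pdivrMr ?normr_gt0//; apply: ub_le_sup => //.
  exists (`|x|^-1 *: x).
    by rewrite /= normrZ normfV normr_id mulVf ?normr_eq0.
  by rewrite phiZ normrM normfV normr_id mulrC.
have p_le a c : (forall x, `|phi a x| <= c * `|x|) -> 0 <= c -> p a <= c.
  move=> ac c0; apply: ge_sup => // _ [x /= x1 <-].
  by apply: le_trans (ac x) _; rewrite ler_piMr.
have p_ge0 a : 0 <= p a.
  apply: ub_le_sup => //; exists 0; rewrite /= ?normr0//.
  by rewrite -(scale0r 0) phiZ mul0r normr0.
have pZle k a : p (k *: a) <= `|k| * p a.
  apply: p_le; last by rewrite mulr_ge0.
  by move=> x; rewrite phiZl normrM -mulrA ler_wpM2l.
exists p; split => //.
- move=> a b; apply: p_le; last by rewrite addr_ge0.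
  by move=> x; rewrite phiDl mulrDl (le_trans (ler_normD _ _))// lerD.
- move=> k a; apply/eqP; rewrite eq_le pZle /=.
  have [->|k0] := eqVneq k 0; first by rewrite normr0 mul0r.
  (* The reverse inequality is [pZle] for the inverse scalar. *)
  have := pZle k^-1 (k *: a).
  rewrite scalerA mulVf// scale1r normfV mulrC ler_pdivlMr ?normr_gt0//.
  by rewrite mulrC.
- move=> a pa0; apply/rowP => i; rewrite mxE; apply: iv.
  apply/funext => x; have := p_ge a x.
  by rewrite pa0 mul0r normr_le0 => /eqP.
Qed.

Lemma norming_family (R : realType) (E : normedModType R) (H : set (E -> R^o)) :
  H `<=` dual E -> norming H -> (eta_set H < +oo)%E ->
  exists (M : nat) (g : 'I_M -> {linear E -> R^o}),
    [/\ forall i x, `|g i x| <= `|x|, forall x, exists i, `|x| <= 2 * g i x &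
        ((ln M%:R)%:E <= 3%:E * eta_set H)%E].
Proof.
move=> HE nH; rewrite /eta_set; case: asboolP => [finH _|_ dimH].
- have finB : finite_set (dual_ball H) by apply: sub_finite_set finH => f [].
  pose B := fset_set (dual_ball H).
  have BE f : (f \in B) = (f \in dual_ball H) by rewrite in_fset_set.
  pose f (i : 'I_#|`B|) := tnth (in_tuple B) i.
  have fB i : dual_ball H (f i).
    by apply: set_mem; rewrite -BE; exact: mem_tnth.
  have [g gf] := linear_family (fun i => (dual_ball_le HE (fB i)).1).
  exists #|`B|, g; split.
  + by move=> i x; rewrite gf; have [_ ->] := dual_ball_le HE (fB i).
  + move=> x; have [h hB hx] := norming_witness x HE nH.
    have /tnthP[i hi] : h \in in_tuple B by rewrite [_ \in _]BE; exact: mem_set.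
    exists i; rewrite gf /f -hi.
    by have := normr_ge0 x; lra.
  + have [h hB _] := norming_witness 0 HE nH.
    have B_gt0 : (0 < #|`B|)%N.
      by rewrite cardfs_gt0; apply/fset0Pn; exists h; rewrite BE; exact: mem_set.
    have BH : (#|`B| <= #|`fset_set H|)%N.
      by apply: fsubset_leq_card; rewrite -fset_set_sub// => ? [].
    have lnBH : ln (#|`B|%:R) <= ln (#|`fset_set H|%:R) :> R.
      by rewrite ler_ln ?posrE ?ltr0n ?ler_nat// (leq_trans B_gt0).
    rewrite -EFinM lee_fin.
    have : 0 <= ln (#|`B|%:R) :> R by rewrite ln_ge0// ler1n.
    by lra.
(* The basis is sought in the dual ball, whose span is no larger than that of [H]. *)
- have dimB : (lin_dim (lin_span (dual_ball H)) <= lin_dim (lin_span H))%E.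
    apply: ereal_sup_le => _ [n [v [Bv iv]] <-]; exists n => //.
    exists v; split => // i.
    have [k [a [u [Bu ->]]]] := Bv i; exists k, a, u; split => // j.
    by case: (Bu j).
  have [m [v [Bv iv mdim comb]]] := lin_indep_maximal (le_lt_trans dimB dimH).
  have lv i := (dual_ball_le HE (Bv i)).1.
  have v1 i := (dual_ball_le HE (Bv i)).2.
  have [p [pD pZ p0 p_ge p_le]] := linear_combination_sup_norm lv v1 iv.
  have [W [sizeW W1 Wnet]] := net_unit_ball pD pZ p0.
  pose phi (a : 'rV[R]_m) : E -> R^o := \sum_i a 0 i *: v i.
  have phi_linear a : linear (phi a).
    move=> k x y; rewrite /phi !fct_sumE scaler_sumr -big_split.
    by apply: eq_bigr => i _; rewrite !scalrfctE lv scalerDr !scalerA mulrC.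
  have phiB a b x : phi (a - b) x = phi a x - phi b x.
    rewrite /phi !fct_sumE -sumrB; apply: eq_bigr => i _.
    by rewrite !scalrfctE !mxE scalerBl.
  pose f (i : 'I_(size W)) := phi (tnth (in_tuple W) i).
  have [g gf] := linear_family (fun i => phi_linear (tnth (in_tuple W) i)).
  have gW x : exists i, `|x| <= 2 * g i x.
    have [h hB hx] := norming_witness x HE nH.
    have [a ha] := comb _ hB.
    have pa1 : p a <= 1.
      by apply: p_le => // y; rewrite mul1r -ha; exact: (dual_ball_le HE hB).2.
    have [w wW aw] := Wnet _ pa1.
    have /tnthP[i wi] : w \in in_tuple W by [].
    exists i; rewrite gf -wi.
    (* [h x] is at least 9/10 of the norm of [x] and moving to the net point loses at most 2/5, so
       half of the norm remains. *)
    have := p_ge (a - w) x; rewrite -/(phi _) phiB -[phi a]ha.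
    have : p (a - w) * `|x| <= 2 / 5 * `|x| by rewrite ler_wpM2r.
    by move=> ?; rewrite ler_norml => /andP[_]; lra.
  exists (size W), g; split => //.
  + move=> i x; rewrite gf; apply: le_trans (p_ge _ _) _.
    by rewrite ler_piMl// W1// mem_tnth.
  (* The existence of an index shows that the net is nonempty, as monotonicity of [ln] requires. *)
  + have [i _] := gW 0.
    have W_gt0 : (0 < size W)%N by exact: leq_ltn_trans (ltn_ord i).
    have : ln (size W)%:R <= 3 * m%:R :> R.
      rewrite -[leRHS]expRK ler_ln ?posrE ?ltr0n ?expR_gt0//.
      apply: (@le_trans _ _ ((8 ^ m)%:R)); first by rewrite ler_nat.
      rewrite mulrC expRM_natl natrX; apply: lerXn2r;
        rewrite ?nnegrE ?expR_ge0//.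
      (* The factor 3 comes from [8 = 2 ^ 3] and [2 <= expR 1]. *)
      rewrite -[X in expR X]mulr1 expRM_natl.
      apply: (@le_trans _ _ (2 ^+ 3)); first by rewrite -natrX.
      by apply: lerXn2r; rewrite ?nnegrE ?expR_ge0//
        (le_trans _ (expR_ge1Dx _)).
    rewrite -lee_fin => /le_trans; apply.
    by rewrite EFinM lee_wpmul2l// (le_trans mdim).
Qed.

(** * Measurability of events, their inclusions and the union bound *)

Lemma dist_lipschitz (R : numDomainType) (V : normedZmodType R) (a y z : V) :
  `| `|y - a| - `|z - a| | <= `|y - z|.
Proof.
by apply: le_trans (ler_dist_dist _ _) _; rewrite opprB addrA subrK.
Qed.

(** The complement is the preimage under [Z] of [h < t], which is open since [h] is Lipschitz. *)
Lemma measurable_superlevel_lipschitz (R : realType) (d : measure_display)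
    (T : measurableType d) (E : normedModType R) (Z : T -> E) (h : E -> R)
    (t : R) : random_vector Z -> (forall y z, `|h y - h z| <= `|y - z|) ->
  measurable [set w | t <= h (Z w)].
Proof.
move=> mZ hlip.
have op : open [set z | h z < t].
  rewrite openE => z /= hz; have tz : 0 < t - h z by rewrite subr_gt0.
  apply: (@filterS _ _ (nbhs_filter z) _ _ _ (nbhsx_ballx z _ tz)) => y.
  rewrite -ball_normE /= => zy; have := hlip z y.
  by rewrite ler_norml => /andP[]; lra.
have : measurable (setT `&` Z @^-1` [set z | h z < t]).
  by apply: mZ => //; exact: sub_sigma_algebra.
rewrite setTI => /measurableC; congr measurable.
by apply/seteqP; split => w /=; rewrite leNgt => /negP.
Qed.

(** By linearity, [u (Z w) - u z0 = u (Z w - z0)] is bounded by the norm of [Z w - z0], so one event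
    contains the other and any tail carries over. *)
Lemma concentrated_of_norm (R : realType) (d : measure_display)
    (T : measurableType d) (P : probability T R) (E : normedModType R)
    (Z : T -> E) (z0 : E) (alpha : R -> \bar R) : random_vector Z ->
  concentrated P (fun w => `|Z w - z0|) 0 alpha ->
  lin_concentrated P Z z0 alpha.
Proof.
move=> mZ conc u u1 t t0; apply: le_trans (conc t t0).
have ulip y z : `| `|u y - u z0| - `|u z - u z0| | <= `|y - z|.
  by apply: le_trans (dist_lipschitz _ _ _) _; rewrite -linearB.
have nlip (y z : E) : `| `| `|y - z0| - 0| - `| `|z - z0| - 0| | <= `|y - z|.
  by rewrite !subr0 !normr_id dist_lipschitz.
apply: le_measure; rewrite ?inE.
- exact: (measurable_superlevel_lipschitz (h := fun z => `|u z - u z0|)).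
- exact: (measurable_superlevel_lipschitz (h := fun z => `| `|z - z0| - 0|)).
- move=> w /= tu; rewrite subr0 normr_id; apply: le_trans tu _.
  by rewrite -linearB.
Qed.

(** On the event, some [g i (Z w - z0)] is at least [t / 2]; this halving becomes the [2 * sigma] of
    the final tail. *)
Lemma norm_tail_union (R : realType) (d : measure_display)
    (T : measurableType d) (P : probability T R) (E : normedModType R)
    (Z : T -> E) (z0 : E) (alpha : R -> R) (M : nat)
    (g : 'I_M -> {linear E -> R^o}) (t : R) : random_vector Z ->
  (forall i x, `|g i x| <= `|x|) -> (forall x, exists i, `|x| <= 2 * g i x) ->
  lin_concentrated P Z z0 (fun t => (alpha t)%:E) -> 0 < t ->
  (P [set w | t <= `|Z w - z0|]%R <= (M%:R * alpha (t / 2))%:E)%E.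
Proof.
move=> mZ g1 gM conc t0.
pose A i := [set w | t / 2 <= `|g i (Z w) - g i z0|].
(* Subadditivity is applied to a sequence indexed by all naturals, so [A] is continued by the empty
   set. *)
pose F k := if insub k is Some i then A i else set0.
have mA i : measurable (A i).
  apply: (measurable_superlevel_lipschitz (h := fun z => `|g i z - g i z0|)) => //.
  move=> y z.
  by apply: le_trans (dist_lipschitz _ _ _) _; rewrite -linearB.
have FE (i : 'I_M) : F i = A i by rewrite /F valK.
apply: (@le_trans _ _ (\sum_(k < M) P (F k))%E).
  apply: content_subadditive.
  - by move=> k kM; rewrite (FE (Ordinal kM)).
  - apply: (measurable_superlevel_lipschitz (h := fun z => `|z - z0|)) => //.
    move=> y z; exact: dist_lipschitz.
  - move=> w /= tw; have [i gi] := gM (Z w - z0).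
    rewrite -bigcup_mkord; exists i => /=; first exact: ltn_ord.
    rewrite FE /A /=; rewrite -linearB; apply: le_trans (ler_norm _).
    by move: gi; lra.
have -> : (M%:R * alpha (t / 2))%:E = (\sum_(k < M) (alpha (t / 2))%:E)%E.
  by rewrite sumEFin sumr_const card_ord mulr_natl.
apply: lee_sum => i _; rewrite FE.
apply: le_trans (conc (g i) (g1 i) (t / 2) _) _; first by rewrite divr_gt0.
by rewrite ge_min lexx.
Qed.

(** * Absorbing the factor [M] into the exponent, and the conclusion *)

(** From [expR (1 / 2) <= 2], itself due to [1 - 1 / 2 <= expR (- (1 / 2))]. Combined with
    [ln M <= 6 * eta] it yields [eta >= 1 / 12]. *)
Lemma ln_natr_ge_half (R : realType) (M : nat) : (1 < M)%N ->
  1 / 2 <= ln M%:R :> R.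
Proof.
move=> M2; rewrite -[leLHS]expRK ler_ln ?posrE ?expR_gt0 ?ltr0n ?(ltnW M2)//.
apply: (@le_trans _ _ 2); last by rewrite ler_nat.
have e0 : 0 < expR (1 / 2) :> R by exact: expR_gt0.
have := expR_ge1Dx (- (1 / 2) : R); rewrite expRN => /(ler_wpM2l (ltW e0)).
by rewrite divff ?gt_eqF//; lra.
Qed.

(** Two regimes, split at [s = 20 * eta]. Below, the right side is at least [C / e >= 1], which the
    cap cannot exceed; above, the exponent absorbs [ln M]. *)
Lemma union_tail_le (R : realType) (M : nat) (C eta s : R) :
  (1 < M)%N -> ln M%:R <= 6 * eta -> expR 1 <= C -> 0 < s ->
  Num.min (M%:R * (C * expR (- s))) 1 <= C * expR (- (s / (2 * 10 * eta))).
Proof.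
move=> M2 Meta C1 s0.
have M0 : 0 < M%:R :> R by rewrite ltr0n ltnW.
have C0 : 0 < C by apply: lt_le_trans C1; exact: expR_gt0.
have ln2 := ln_natr_ge_half R M2.
have eta0 : 0 < eta by lra.
have k0 : 0 < 2 * 10 * eta by lra.
rewrite ge_min; have [sle|sgt] := leP s (2 * 10 * eta).
  apply/orP; right; apply: (@le_trans _ _ (C * expR (- 1))).
    by rewrite expRN -ler_pdivrMr ?invr_gt0 ?expR_gt0// invrK mul1r.
  by rewrite ler_pM2l// ler_expR lerN2 ler_pdivrMr// mul1r.
apply/orP; left; rewrite mulrCA ler_pM2l// -{1}[M%:R]lnK ?posrE//.
rewrite -expRD ler_expR.
set x := s / (2 * 10 * eta).
have sx : s = x * (2 * 10 * eta) by rewrite divfK ?gt_eqF.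
have x1 : 1 < x by rewrite ltr_pdivlMr// mul1r.
(* The claim amounts to [ln M + x <= 20 * eta * x]. As [x > 1] and [eta >= 1 / 12], one has
   [ln M <= 6 * eta * x] and [x <= 12 * eta * x], and 6 + 12 <= 20: hence the constant 10. *)
rewrite sx; nra.
Qed.

Lemma eta_set_ge0 (R : realType) (E : normedModType R) (H : set (E -> R^o)) :
  (0 <= eta_set H)%E.
Proof.
rewrite /eta_set; case: ifP => _.
  case: #|` _|%fset => [|k]; first by rewrite ln0.
  by rewrite lee_fin ln_ge0// ler1n.
apply: ereal_sup_ubound; exists 0%N => //; exists (fun=> 0).
by split => [[]|a _ []].
Qed.

Lemma norm_degree_family (R : realType) (E : normedModType R) (eta : R) :
  norm_degree E = eta%:E ->
  exists (M : nat) (g : 'I_M -> {linear E -> R^o}),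
    [/\ forall i x, `|g i x| <= `|x|, forall x, exists i, `|x| <= 2 * g i x &
        (1 < M)%N -> ln M%:R <= 6 * eta].
Proof.
move=> etaE.
have eta0 : 0 <= eta.
  rewrite -lee_fin -etaE; apply: le_ereal_inf_tmp => _ [H _ <-].
  exact: eta_set_ge0.
(* For [eta = 0] the slack cannot be [eta]. With 1/12 one gets [ln M <= 1 / 4 < 1 / 2], which
   excludes [M >= 2]. *)
pose e := if eta == 0 then 1 / 12 else eta.
have e0 : 0 < e.
  by rewrite /e; case: eqVneq => // ?; rewrite lt_neqAle eq_sym; apply/andP.
have : (norm_degree E < (eta + e)%:E)%E by rewrite etaE lte_fin ltrDl.
move=> /ereal_inf_lt[_ [H [HE nH] <-] etaH].
have [M [g [g1 gM lnM]]] := norming_family HE nH (lt_trans etaH (ltry _)).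
exists M, g; split => //.
have {lnM} : ln M%:R <= 3 * (eta + e).
  rewrite -lee_fin; apply: le_trans lnM _; rewrite EFinM lee_wpmul2l//.
  exact: ltW.
rewrite /e; case: eqVneq => [-> lnM M2|_ ? _]; last by lra.
by have := ln_natr_ge_half R M2; lra.
Qed.

Theorem proposition2p11 (R : realType) :
  exists c : R, 0 < c /\
    forall (E : normedModType R) (d : measure_display) (T : measurableType d)
      (P : probability T R) (Z : T -> E) (z0 : E) (C q sigma : R),
      random_vector Z -> expR 1 <= C -> 0 < q -> 0 < sigma ->
      (lin_concentrated P Z z0 (fun t => (C * expR (- ((t / sigma) `^ q)))%:E) ->
       concentrated P (fun w => `|Z w - z0|) 0
         (fun t => C%:E * expeR (- (((t / (2 * sigma)) `^ q)%:E
                                     / ((2 * c)%:E * norm_degree E))))%E) /\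
      (concentrated P (fun w => `|Z w - z0|) 0
         (fun t => (C * expR (- ((t / sigma) `^ q)))%:E) ->
       lin_concentrated P Z z0 (fun t => (C * expR (- ((t / sigma) `^ q)))%:E)).
Proof.
exists 10; split => // E d T P Z z0 C q sigma mZ C1 q0 sigma0.
split; last exact: concentrated_of_norm.
move=> conc t t0.
have C0 : 0 < C by apply: lt_le_trans C1; exact: expR_gt0.
under eq_set do rewrite subr0 normr_id.
have mA : measurable [set w | t <= `|Z w - z0|].
  apply: (measurable_superlevel_lipschitz (h := fun z => `|z - z0|)) => // y z.
  exact: dist_lipschitz.
have P1 := probability_le1 P mA.
rewrite le_min P1 andbT.
set s := (t / (2 * sigma)) `^ q.
have s0 : 0 < s by rewrite powR_gt0// divr_gt0// mulr_gt0.
case etaE : (norm_degree E) => [eta| |]; last first.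
- have : (0 <= norm_degree E)%E.
    by apply: le_ereal_inf_tmp => _ [H _ <-]; exact: eta_set_ge0.
  by rewrite etaE.
(* For infinite degree the exponent is 0 and the tail is the constant [C >= 1]. *)
- rewrite gt0_muley ?lte_fin// invey mule0 oppe0 expeR0 mule1.
  apply: le_trans P1 _; rewrite lee_fin; apply: le_trans C1.
  by have := expR_ge1Dx (1 : R); lra.
have [M [g [g1 gM lnM]]] := norm_degree_family etaE.
have [M1|M2] := leqP M 1.
  (* A single index serves [x] and [- x], so the norm of [x] is at most both [2 * g i x] and its
     opposite. Thus [E] is trivial and the event is empty for [t > 0]. *)
  have E0 (x : E) : `|x| = 0.
    have [i gi] := gM x; have [j gj] := gM (- x).
    have ij : i = j.
      apply/val_inj; move: M1 (ltn_ord i) (ltn_ord j); rewrite /=; lia.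
    apply/eqP; rewrite eq_le normr_ge0 andbT; move: gj.
    by rewrite -ij normrN linearN /=; lra.
  have -> : [set w | t <= `|Z w - z0|] = set0.
    by apply/seteqP; split => // w /=; rewrite E0 leNgt t0.
  by rewrite measure0; apply: mule_ge0; [rewrite lee_fin ltW|exact: expeR_ge0].
have st : (t / 2 / sigma) `^ q = s by rewrite /s invfM mulrA.
have := norm_tail_union mZ g1 gM conc t0; rewrite st => PM.
have := union_tail_le M2 (lnM M2) C1 s0.
(* [M >= 2] makes [eta] positive, so the extended inverse is the real one and not [+oo]. *)
have eta0 : 2 * 10 * eta != 0.
  by have := ln_natr_ge_half R M2; have := lnM M2; lra.
rewrite -EFinM inver (negbTE eta0) -EFinM /= -lee_fin; apply: le_trans.
by rewrite EFin_min le_min PM P1.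
Qed.
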